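(* For every $d\in\mathbb{N}$ and every CPTP map $\mathcal{E}$ on $\mathbb{C}^{d\times d}$, $$\alpha(\mathcal{E}) := \left\| \mathcal{E}\!\left(\tfrac{1}{d}\mathbb{I}_d\right)-\tfrac{1}{d}\mathbb{I}_d\right\|_2 \le \frac{\sqrt{2}\,(d+1)\,r(\mathcal{E})}{d}.$$
   Context: $\|M\|_p=(\mathrm{Tr}(M^\dagger M)^{p/2})^{1/p}$ is the Schatten $p$-norm. For a CPTP map $\mathcal{E}$ on $d\times d$ matrices and a pure state $\psi$, $r(\mathcal{E},\psi)=1-\mathrm{Tr}[\psi\,\mathcal{E}(\psi)]$, and the (average gate) infidelity is $r(\mathcal{E})=\int \mathrm{d}\psi\, r(\mathcal{E},\psi)$ with respect to the Haar (unitarily invariant) probability measure on pure states of $\mathbb{C}^d$. *)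

(* Defs.v *)
From HB Require Import structures.
From mathcomp Require Import all_boot all_order all_algebra.
Set Implicit Arguments. Unset Strict Implicit. Unset Printing Implicit Defensive.
Import Order.TTheory GRing.Theory Num.Theory.
Local Open Scope ring_scope.

Section QDefs.
Variable C : numClosedFieldType.

Definition adj m n (M : 'M[C]_(m, n)) : 'M[C]_(n, m) := (map_mx Num.conj M)^T.

Definition schatten2 d (M : 'M[C]_d) : C := sqrtC (\tr (adj M *m M)).

(* unit vectors of C^d (pure states psi = v v^dagger) *)
Definition unit_vec d (v : 'cV[C]_d) : Prop := adj v *m v = 1%:M.

Definition unitary d (U : 'M[C]_d) : Prop := adj U *m U = 1%:M.

Definition proj_of d (v : 'cV[C]_d) : 'M[C]_d := v *m adj v.

(* positivity of a k x k block matrix with d x d blocks, i.e. of an element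
   of M_k (M_d) = M_{kd}: v^dagger X v >= 0 for every v in C^{kd} *)
Definition psd_block d k (X : 'I_k -> 'I_k -> 'M[C]_d) : Prop :=
  forall v : 'I_k -> 'cV[C]_d,
    0 <= \sum_(i < k) \sum_(j < k) (adj (v i) *m X i j *m v j) 0 0.

Definition completely_positive d (E : 'M[C]_d -> 'M[C]_d) : Prop :=
  forall k (X : 'I_k -> 'I_k -> 'M[C]_d),
    psd_block X -> psd_block (fun i j => E (X i j)).

Definition trace_preserving d (E : 'M[C]_d -> 'M[C]_d) : Prop :=
  forall X, \tr (E X) = \tr X.

Definition CPTP d (E : {linear 'M[C]_d -> 'M[C]_d}) : Prop :=
  completely_positive E /\ trace_preserving E.

Definition infid_at d (E : 'M[C]_d -> 'M[C]_d) (v : 'cV[C]_d) : C :=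
  1 - \tr (proj_of v *m E (proj_of v)).

(* Functions on pure states that are (on the unit sphere) polynomials of
   bidegree (2,2) in (conj v, v).  r(E, .) is of this form. *)
Definition poly22 d (f : 'cV[C]_d -> C) : Prop :=
  exists c : 'I_d -> 'I_d -> 'I_d -> 'I_d -> C,
    forall v, unit_vec v ->
      f v = \sum_(i < d) \sum_(j < d) \sum_(k < d) \sum_(l < d)
              c i j k l * (v i 0)^* * (v j 0)^* * v k 0 * v l 0.

(* mu is the Haar (unitarily invariant, normalized) average over pure
   states, on the class poly22: linear, depends only on values on pure
   states, invariant under every unitary, and mu(1) = 1.  These axioms
   determine mu uniquely on poly22 (and the Haar integral satisfies them). *)
Definition haar_avg22 d (mu : ('cV[C]_d -> C) -> C) : Prop :=
  [/\ forall f g, poly22 f -> poly22 g ->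
        mu (fun v => f v + g v) = mu f + mu g,
      forall (a : C) f, poly22 f -> mu (fun v => a * f v) = a * mu f,
      forall f g, poly22 f -> (forall v, unit_vec v -> f v = g v) ->
        mu f = mu g,
      forall f (U : 'M[C]_d), poly22 f -> unitary U ->
        mu (fun v => f (U *m v)) = mu f
    & mu (fun _ => 1) = 1].

Definition infid d (mu : ('cV[C]_d -> C) -> C) (E : 'M[C]_d -> 'M[C]_d) : C :=
  mu (infid_at E).

End QDefs.

(* Main.v *)
(* Take a Kraus decomposition [E X = sum_s K_s X K_s^dag].  Trace preservation
   gives [E 1 - 1 = sum_s [K_s, K_s^dag]], and a commutator does not change
   when [K_s] is replaced by its traceless part [A_s].  Since
   [|[A, A^dag]|_2 <= sqrt 2 |A|_2 ^ 2], the triangle inequality bounds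
   [|E 1 - 1|_2] by [sqrt 2 (d - sum_s |tr K_s|^2 / d)].  The right-hand side is
   [sqrt 2 (d + 1) r(E)], because unitary invariance forces the fourth moments
   of the Haar average to be
   [mu (v_i^* v_j^* v_k v_l) = (d_ik d_jl + d_il d_jk) / (d (d + 1))]. *)
Require Import Defs.
From HB Require Import structures.
From mathcomp Require Import all_boot all_order all_algebra.
From mathcomp Require Import fingroup perm spectral sesquilinear ring.
Import Order.TTheory GRing.Theory Num.Theory.
Local Open Scope ring_scope.

(** * Sums against Kronecker deltas *)

Lemma sum_delta {R : pzSemiRingType} {I : finType} (k : I) (F : I -> R) :
  \sum_i (i == k)%:R * F i = F k.
Proof.
rewrite (bigD1 k) //= eqxx mul1r big1 ?addr0 // => i /negPf->.
by rewrite mul0r.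
Qed.

Lemma sum_delta2 {R : pzSemiRingType} {I : finType} (i j : I)
    (F : I -> I -> R) :
  \sum_k \sum_l (k == i)%:R * (l == j)%:R * F k l = F i j.
Proof.
under eq_bigr => k _ do
  (under eq_bigr => l _ do rewrite -mulrA; rewrite -mulr_sumr sum_delta).
by rewrite sum_delta.
Qed.

Lemma adjE (C : numClosedFieldType) m n (M : 'M[C]_(m, n)) i j :
  adj M i j = (M j i)^*.
Proof. by rewrite !mxE. Qed.

(** * Polynomials of bidegree (2,2) on the unit sphere *)

Section HaarMoments.
Local Set Implicit Arguments.
Local Unset Strict Implicit.
Local Unset Printing Implicit Defensive.
Variables (C : numClosedFieldType) (d : nat).

Lemma unit_vec_sum (v : 'cV[C]_d) :
  unit_vec v -> \sum_i (v i 0)^* * v i 0 = 1.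
Proof.
move=> /matrixP/(_ 0 0); rewrite !mxE eqxx mulr1n => <-.
by apply: eq_bigr => i _; rewrite !mxE.
Qed.

Definition monom (i j k l : 'I_d) (v : 'cV[C]_d) : C :=
  (v i 0)^* * (v j 0)^* * v k 0 * v l 0.

Lemma poly22_ext f g :
  poly22 f -> (forall v : 'cV[C]_d, unit_vec v -> f v = g v) -> poly22 g.
Proof. by move=> [c fE] fg; exists c => v vu; rewrite -fg // fE. Qed.

Lemma poly22_monom i j k l : poly22 (monom i j k l).
Proof.
exists (fun a b c e =>
  (a == i)%:R * ((b == j)%:R * ((c == k)%:R * (e == l)%:R))).
move=> v _; symmetry.
under eq_bigr => a _ do under eq_bigr => b _ do under eq_bigr => c _ do
  (under eq_bigr => e _ do
     rewrite -!mulrA 3!(mulrCA _ (e == l)%:R); rewrite sum_delta).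
under eq_bigr => a _ do under eq_bigr => b _ do
  (under eq_bigr => c _ do rewrite 2!(mulrCA _ (c == k)%:R); rewrite sum_delta).
under eq_bigr => a _ do
  (under eq_bigr => b _ do rewrite (mulrCA _ (b == j)%:R); rewrite sum_delta).
by rewrite sum_delta /monom !mulrA.
Qed.

Lemma poly22Z (a : C) f : poly22 f -> poly22 (fun v : 'cV[C]_d => a * f v).
Proof.
move=> [c fE]; exists (fun i j k l => a * c i j k l) => v vu.
rewrite fE // !big_distrr; apply: eq_bigr => i _ /=.
rewrite !big_distrr; apply: eq_bigr => j _ /=.
rewrite !big_distrr; apply: eq_bigr => k _ /=.
by rewrite !big_distrr; apply: eq_bigr => l _ /=; rewrite !mulrA.
Qed.

Lemma poly22D f g :
  poly22 f -> poly22 g -> poly22 (fun v : 'cV[C]_d => f v + g v).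
Proof.
move=> [c fE] [c' gE].
exists (fun i j k l => c i j k l + c' i j k l) => v vu.
rewrite fE // gE // -big_split; apply: eq_bigr => i _ /=.
rewrite -big_split; apply: eq_bigr => j _ /=.
rewrite -big_split; apply: eq_bigr => k _ /=.
by rewrite -big_split; apply: eq_bigr => l _ /=; rewrite !mulrDl.
Qed.

Lemma poly22_0 : poly22 (fun _ : 'cV[C]_d => 0).
Proof.
exists (fun _ _ _ _ => 0) => v _; symmetry; do 4!apply: big1 => ? _.
by rewrite !mul0r.
Qed.

Lemma poly22_sum (I : finType) (F : I -> 'cV[C]_d -> C) :
  (forall i, poly22 (F i)) -> poly22 (fun v => \sum_i F i v).
Proof.
move=> pF; elim: (index_enum I) => [|i s IHs].
  by apply: poly22_ext poly22_0 _ => v _; rewrite big_nil.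
by apply: poly22_ext (poly22D (pF i) IHs) _ => v _; rewrite big_cons.
Qed.

Definition quartic (c : 'I_d -> 'I_d -> 'I_d -> 'I_d -> C) (v : 'cV[C]_d) : C :=
  \sum_i \sum_j \sum_k \sum_l c i j k l * monom i j k l v.

Lemma poly22_quartic c : poly22 (quartic c).
Proof.
by do 4!apply: poly22_sum => ?; apply: poly22Z; apply: poly22_monom.
Qed.

(** * Fourth moments of the Haar average *)

Variable mu : ('cV[C]_d -> C) -> C.
Hypothesis hmu : haar_avg22 mu.

Lemma haar_ext f g :
  poly22 f -> (forall v, unit_vec v -> f v = g v) -> mu f = mu g.
Proof. by case: hmu => _ _ + _ _; apply. Qed.

Lemma haarZ (a : C) f : poly22 f -> mu (fun v => a * f v) = a * mu f.
Proof. by case: hmu => _ + _ _ _; apply. Qed.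

Lemma haar_sum (I : finType) (F : I -> 'cV[C]_d -> C) :
  (forall i, poly22 (F i)) -> mu (fun v => \sum_i F i v) = \sum_i mu (F i).
Proof.
case: hmu => muD _ _ _ _ pF.
(* Additivity of [mu] is given on [poly22] only, so the induction carries the membership of each
   partial sum. *)
suff [] : poly22 (fun v => \sum_i F i v) /\
          mu (fun v => \sum_i F i v) = \sum_i mu (F i) by [].
elim: (index_enum I) => [|i s [ps IHs]].
  have p0 : poly22 (fun v => \sum_(i <- [::]) F i v).
    by apply: poly22_ext poly22_0 _ => v _; rewrite big_nil.
  split=> //; rewrite [RHS]big_nil -[RHS](mul0r (mu (fun _ => 0))).
  rewrite -haarZ; last exact: poly22_0.
  by apply: haar_ext => // v _; rewrite big_nil mul0r.
have p1 : poly22 (fun v => \sum_(j <- i :: s) F j v).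
  by apply: poly22_ext (poly22D (pF i) ps) _ => v _; rewrite big_cons.
split=> //; rewrite big_cons -IHs -muD //.
by apply: haar_ext => // v _; rewrite big_cons.
Qed.

Definition moment i j k l : C := mu (monom i j k l).

Lemma haar_quartic c :
  mu (quartic c) =
  \sum_i \sum_j \sum_k \sum_l c i j k l * moment i j k l.
Proof.
have p i j k l : poly22 (fun v => c i j k l * monom i j k l v).
  exact/poly22Z/poly22_monom.
rewrite haar_sum; last by move=> i; do 3!apply: poly22_sum => ?.
apply: eq_bigr => i _; rewrite haar_sum; last first.
  by move=> ?; do 2!apply: poly22_sum => ?.
apply: eq_bigr => j _; rewrite haar_sum; last first.
  by move=> ?; apply: poly22_sum => ?.
apply: eq_bigr => k _; rewrite haar_sum; last by move=> ?.
by apply: eq_bigr => l _; rewrite haarZ //; apply: poly22_monom.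
Qed.

Lemma moment_unitary (U : 'M[C]_d) i j k l : unitary U ->
  moment i j k l = mu (fun v => monom i j k l (U *m v)).
Proof.
by case: hmu => _ _ _ muU _ uU; rewrite muU //; apply: poly22_monom.
Qed.

(** Permutation matrices are unitary, so relabelling the coordinates preserves the average. *)
Lemma moment_perm (s : {perm 'I_d}) i j k l :
  moment (s i) (s j) (s k) (s l) = moment i j k l.
Proof.
have uU : unitary (perm_mx s : 'M[C]_d).
  rewrite /unitary; have -> : adj (perm_mx s) = (perm_mx s)^T :> 'M[C]_d.
    by apply/matrixP => a b; rewrite !mxE conjC_nat.
  by rewrite tr_perm_mx -perm_mxM mulVg perm_mx1.
rewrite (moment_unitary i j k l uU); apply: haar_ext (poly22_monom _ _ _ _) _.
by move=> v _; rewrite /monom -row_permE !mxE.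
Qed.

(** The diagonal unitary with entries [z] multiplies the monomial by the displayed scalar, so the
    moment equals that scalar times itself. The phase is ['i] because a sign -1 could not exclude
    patterns such as i = j, k = l with i and k distinct. *)
Lemma moment_phase p i j k l :
  let z := fun a : 'I_d => if a == p then 'i else 1 : C in
  (z i)^* * (z j)^* * z k * z l != 1 -> moment i j k l = 0.
Proof.
move=> z z1; pose U : 'M[C]_d := diag_mx (\row_a z a).
have zz a : (z a)^* * z a = 1.
  rewrite /z; case: ifP => _; rewrite ?conjC1 ?mulr1 //.
  by rewrite conjCi mulNr -expr2 sqrCi opprK.
have Uv (v : 'cV[C]_d) a : (U *m v) a 0 = z a * v a 0.
  rewrite !mxE (bigD1 a) //= !mxE eqxx mulr1n big1 ?addr0 // => b ba.
  by rewrite !mxE eq_sym (negPf ba) mulr0n mul0r.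
have uU : unitary U.
  apply/matrixP => a b; rewrite mxE (bigD1 a) //= big1 => [|c ca].
    rewrite adjE !mxE eqxx addr0 mulr1n.
    have [->|ab] := eqVneq; first by rewrite mulr1n zz.
    by rewrite mulr0n mulr0.
  by rewrite adjE !mxE (negPf ca) mulr0n conjC0 mul0r.
have := moment_unitary i j k l uU.
rewrite -(haar_ext
  (f := fun v => (z i)^* * (z j)^* * z k * z l * monom i j k l v)).
- rewrite haarZ; last exact: poly22_monom.
  move/eqP; rewrite -subr_eq0 -{1}[moment _ _ _ _]mul1r -mulrBl mulf_eq0.
  by rewrite subr_eq0 eq_sym (negPf z1) => /eqP.
- exact/poly22Z/poly22_monom.
- by move=> v _; rewrite /monom !Uv !rmorphM; ring.
Qed.

(** The multisets {i,j} and {k,l} differ. Each case puts the phase on a coordinate that occurs more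
    often among the conjugated indices; the scalar is then -1 or [- 'i]. *)
Lemma moment_offdiag i j k l :
  ~~ ((i == k) && (j == l)) -> ~~ ((i == l) && (j == k)) ->
  moment i j k l = 0.
Proof.
have N1 : (-1 : C) != 1 by rewrite eq_sym -addr_eq0 -(natrD _ 1 1) pnatr_eq0.
have ii : ('i : C) * 'i = -1 by rewrite -expr2 sqrCi.
have i1 : ('i : C) != 1.
  by apply: contraNneq N1 => iE; rewrite -ii iE mulr1.
have Ni1 : - ('i : C) != 1.
  by apply: contraNneq N1 => iE; rewrite -ii -mulrNN iE mulr1.
move=> h1 h2.
have [ji|ji] := eqVneq j i.
  apply: (@moment_phase i); rewrite ji eqxx.
  move: h1 h2; rewrite ji !(eq_sym i).
  by case: (k == i); case: (l == i);
    rewrite //= !conjCi mulNr mulrN opprK ii ?mulr1 ?mulN1r.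
have [ki|ki] := eqVneq k i; have [li|li] := eqVneq l i.
- apply: (@moment_phase j); rewrite ki li eqxx (eq_sym i) (negPf ji) /=.
  by rewrite conjC1 conjCi !mulr1 mul1r.
- apply: (@moment_phase j); rewrite ki eqxx (eq_sym i) (negPf ji).
  move: h1; rewrite ki eqxx /= (eq_sym j) => /negPf->.
  by rewrite conjC1 conjCi !mulr1 mul1r.
- apply: (@moment_phase j); rewrite li eqxx (eq_sym i) (negPf ji).
  move: h2; rewrite li eqxx /= (eq_sym j) => /negPf->.
  by rewrite conjC1 conjCi !mulr1 mul1r.
- apply: (@moment_phase i).
  by rewrite eqxx (negPf ji) (negPf ki) (negPf li) conjC1 conjCi !mulr1.
Qed.

(* Halving the diagonal gives [moment_pair] the same form for [i = j]. *)
Definition pair_moment i j : C := moment i j i j / (1 + (i == j)%:R).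

(** Only the two pairings of {k,l} with {i,j} survive, and they have the same moment since the last
    two factors commute. For i = j both terms fire, which the halving absorbs. *)
Lemma moment_pair i j k l :
  moment i j k l =
  ((k == i)%:R * (l == j)%:R + (l == i)%:R * (k == j)%:R) * pair_moment i j.
Proof.
have sym : moment i j j i = moment i j i j.
  apply: haar_ext (poly22_monom _ _ _ _) _ => v _.
  by rewrite /monom mulrAC.
have momE : moment i j i j = (1 + (i == j)%:R) * pair_moment i j.
  by rewrite /pair_moment mulrC divfK // -(natrD _ 1) pnatr_eq0.
rewrite -!natrM !mulnb.
have [/andP[/eqP-> /eqP->]|h1] := boolP ((k == i) && (l == j)).
  by rewrite momE (eq_sym j) andbb.
have [/andP[/eqP li /eqP kj]|h2] := boolP ((l == i) && (k == j)).
  by move: h1; rewrite li kj (eq_sym j) andbb sym momE addrC => /negPf->.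
by rewrite addr0 mul0r moment_offdiag // ?(eq_sym i) ?(eq_sym j).
Qed.

(* The witness is [1 - c u u^T] with [u = e_p + e_q] and [c = (1 - i) / 2]. *)
Lemma exists_unitary_flat_row (p q : 'I_d) : p != q ->
  exists2 U : 'M[C]_d, unitary U &
    forall a, (U p a)^* * U p a = 2^-1 * ((a == p)%:R + (a == q)%:R).
Proof.
move=> pq; have qp : q != p by rewrite eq_sym.
have two : (2 : C) != 0 by rewrite pnatr_eq0.
have ii : ('i : C) * 'i = -1 by rewrite -expr2 sqrCi.
pose c : C := (1 - 'i) / 2.
have cc : c^* = (1 + 'i) / 2.
  by rewrite /c rmorphM rmorphB fmorphV /= conjC1 conjCi conjC_nat opprK.
pose u : 'cV[C]_d := delta_mx p 0 + delta_mx q 0.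
have uu : u^T *m u = 2%:M.
  apply/matrixP => a b; rewrite !ord1 !mxE eqxx mulr1n.
  under eq_bigr => i _ do rewrite !mxE eqxx !andbT mulrDl.
  by rewrite big_split /= !sum_delta !eqxx (negPf pq) (negPf qp) addr0 add0r.
exists (1%:M - c *: (u *m u^T)).
  rewrite /unitary.
  have -> : adj (1%:M - c *: (u *m u^T)) = 1%:M - c^* *: (u *m u^T).
    apply/matrixP => a b; rewrite !mxE rmorphB rmorphM rmorph_sum /=.
    rewrite conjC_nat eq_sym.
    congr (_ - _ * _); apply: eq_bigr => i _.
    by rewrite !mxE rmorphM !rmorphD /= !conjC_nat mulrC.
  have PP : (u *m u^T) *m (u *m u^T) = 2 *: (u *m u^T).
    by rewrite mulmxA -(mulmxA u) uu -mulmxA mul_scalar_mx -scalemxAr.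
  rewrite mulmxBl mul1mx mulmxBr mulmx1 -scalemxAl -scalemxAr PP !scalerA.
  rewrite -addrA -opprD -!scalerBl -scalerDl.
  (* The matrix u u^T squares to twice itself, so unitarity says that twice the real part of c
     equals 2 |c|^2; both are 1. *)
  have -> : c + (c^* - c^* * c * 2) = 0.
    rewrite cc /c; apply: (mulIf two); rewrite mul0r.
    have -> : ((1 - 'i) / 2 +
        ((1 + 'i) / 2 - (1 + 'i) / 2 * ((1 - 'i) / 2) * 2)) * 2 = 1 + 'i * 'i :> C by field.
    by rewrite ii subrr.
  by rewrite scale0r subr0.
(* Row p has entries 1 - c at p and - c at q, both of squared modulus 1/2. *)
move=> a; rewrite !mxE big_ord1 !mxE !eqxx !andbT (negPf pq) addr0 mul1r.
rewrite rmorphB rmorphM rmorphD /= !conjC_nat cc /c eq_sym.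
have [ap|ap] := eqVneq a p; have [aq|aq] := eqVneq a q => //=.
- by move: pq; rewrite -ap aq eqxx.
- rewrite !addr0 !mulr1.
  by have -> : (1 - (1 + 'i) / 2) * (1 - (1 - 'i) / 2)
      = 4^-1 * (1 - 'i * 'i) :> C; [field | rewrite ii; field].
- rewrite !sub0r !add0r !mulr1.
  by have -> : (- ((1 + 'i) / 2)) * (- ((1 - 'i) / 2))
      = 4^-1 * (1 - 'i * 'i) :> C; [field | rewrite ii; field].
- by rewrite !addr0 !mulr0 subr0 mulr0.
Qed.

(** The polynomial is the fourth power of the norm of v. It presents the constant 1 as an element of
    [poly22], so that normalization becomes a condition on the moments. *)
Lemma quartic_delta (v : 'cV[C]_d) : unit_vec v ->
  quartic (fun i j k l => (k == i)%:R * (l == j)%:R) v = 1.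
Proof.
move=> vu; rewrite -[RHS]mulr1 -[in RHS](unit_vec_sum vu) [RHS]mulr_suml.
apply: eq_bigr => k _; rewrite mulr_sumr; apply: eq_bigr => l _.
by rewrite sum_delta2 /monom; ring.
Qed.

Lemma haar_quartic_pair c :
  mu (quartic c) = \sum_i \sum_j (c i j i j + c i j j i) * pair_moment i j.
Proof.
rewrite haar_quartic; apply: eq_bigr => i _; apply: eq_bigr => j _.
rewrite mulrDl -(sum_delta2 i j (fun k l => c i j k l * pair_moment i j)).
rewrite -[X in _ = _ + X](sum_delta2 j i
  (fun k l => c i j k l * pair_moment i j)).
rewrite -big_split; apply: eq_bigr => k _ /=.
rewrite -big_split; apply: eq_bigr => l _ /=.
by rewrite moment_pair; ring.
Qed.

(** Rotating by a unitary whose row p is spread evenly over p and q ties mixed moments to diagonal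
    ones, a relation beyond the reach of permutations and phases. *)
Lemma pair_moment_rotation p q : p != q ->
  moment p p p p =
  2^-1 * (pair_moment p p + pair_moment p q + pair_moment q p + pair_moment q q).
Proof.
move=> /exists_unitary_flat_row[U uU Urow].
rewrite (moment_unitary _ _ _ _ uU).
pose g a := (U p a)^* * U p a.
pose c i j k l := (U p i)^* * (U p j)^* * U p k * U p l.
transitivity (mu (quartic c)).
  symmetry; apply: haar_ext; first exact: poly22_quartic.
  move=> v _; rewrite /monom !mxE !rmorph_sum /quartic.
  rewrite -!mulrA [RHS]mulr_suml; apply: eq_bigr => i _.
  rewrite [RHS]mulrCA [RHS]mulr_suml; apply: eq_bigr => j _.
  rewrite [RHS]mulrA [RHS]mulrCA [RHS]mulr_suml; apply: eq_bigr => k _.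
  rewrite [RHS]mulrA [RHS]mulr_sumr; apply: eq_bigr => l _.
  by rewrite /c /monom !rmorphM; ring.
rewrite haar_quartic_pair.
(* Both pairings carry the same weight |U_pi|^2 |U_pj|^2, hence the factor 2. *)
transitivity (\sum_i g i * \sum_j g j * (2 * pair_moment i j)).
  apply: eq_bigr => i _; rewrite mulr_sumr; apply: eq_bigr => j _.
  by rewrite /c /g; ring.
have gE (F : 'I_d -> C) : \sum_i g i * F i = 2^-1 * (F p + F q).
  under eq_bigr => i _ do rewrite /g Urow -mulrA mulrDl.
  by rewrite -mulr_sumr big_split /= !sum_delta.
by rewrite !gE; field.
Qed.

Hypothesis d_gt0 : (0 < d)%N.

(** Permutations make all diagonal values equal, the rotation relation extends this to all pairs,
    and averaging the constant 1 fixes the common value. *)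
Lemma pair_momentE i j : pair_moment i j = (d%:R * d.+1%:R)^-1.
Proof.
pose i0 := Ordinal d_gt0; pose a := moment i0 i0 i0 i0.
have mom p : moment p p p p = a by rewrite -(moment_perm (tperm p i0)) tpermL.
have diag p : pair_moment p p = a / 2 by rewrite /pair_moment eqxx mom.
have sym p q : pair_moment p q = pair_moment q p.
  rewrite /pair_moment eq_sym; congr (_ / _).
  apply: haar_ext (poly22_monom _ _ _ _) _ => v _.
  by rewrite /monom; ring.
have all_eq p q : pair_moment p q = a / 2.
  have [<-|/pair_moment_rotation] := eqVneq p q; first exact: diag.
  rewrite mom !diag -(sym p q) => h.
  (* The rotation relation reads a = (a + 2 x) / 2 for the mixed value x, so x = a / 2. *)
  have -> : pair_moment p q =
      2^-1 * (a / 2 + pair_moment p q + pair_moment p q + a / 2) - a / 2 by field.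
  by rewrite -h; field.
have : mu (quartic (fun i j k l => (k == i)%:R * (l == j)%:R)) = 1.
  case: hmu => _ _ _ _ mu1; rewrite -[RHS]mu1.
  apply: haar_ext; first exact: poly22_quartic.
  by move=> v /quartic_delta.
rewrite haar_quartic_pair.
under eq_bigr => p _ do (under eq_bigr => q _ do
   rewrite !eqxx mul1r -natrM mulnb (eq_sym p) andbb all_eq mulrDl mul1r;
   rewrite big_split /= sumr_const sum_delta card_ord).
rewrite sumr_const card_ord all_eq => h.
have dn0 : (d%:R : C) != 0 by rewrite pnatr_eq0 -lt0n.
have d1n0 : (d.+1%:R : C) != 0 by rewrite pnatr_eq0.
apply: (mulIf (mulf_neq0 dn0 d1n0)); rewrite mulVf ?mulf_neq0 // -[RHS]h.
ring.
Qed.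

Lemma haar_quarticE c :
  mu (quartic c) = (\sum_i \sum_j (c i j i j + c i j j i)) / (d%:R * d.+1%:R).
Proof.
rewrite haar_quartic_pair mulr_suml; apply: eq_bigr => i _.
by rewrite mulr_suml; apply: eq_bigr => j _; rewrite pair_momentE.
Qed.

(** The fidelity at v is v^dag E(v v^dag) v, a quartic with coefficients [c]. Its two pairings give
    tr E(1) and, up to the factor d^2, the entanglement fidelity. *)
Lemma infidE (E : {linear 'M[C]_d -> 'M[C]_d}) :
  infid mu E =
  1 - (\sum_i \sum_j (E (delta_mx j j) i i + E (delta_mx i j) i j))
      / (d%:R * d.+1%:R).
Proof.
pose c (i j k l : 'I_d) : C := E (delta_mx l j) i k.
have fid v : \tr (proj_of v *m E (proj_of v)) = quartic c v.
  rewrite [X in E X]/proj_of -mulmxA mxtrace_mulC -mulmxA trace_mx11 mxE.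
  have -> : v *m adj v = \sum_j \sum_k (v k 0 * (v j 0)^*) *: delta_mx k j.
    rewrite [LHS]matrix_sum_delta exchange_big.
    by do 2!apply: eq_bigr => ? _; rewrite !mxE big_ord1 !mxE.
  apply: eq_bigr => i _; rewrite [X in _ * X]mxE mulr_sumr.
  rewrite [RHS]exchange_big; apply: eq_bigr => k _.
  rewrite linear_sum summxE mulr_suml mulr_sumr; apply: eq_bigr => j _ /=.
  rewrite linear_sum summxE mulr_suml mulr_sumr; apply: eq_bigr => l _ /=.
  by rewrite linearZ adjE mxE /c /monom; ring.
have pfid : poly22 (fun v => \tr (proj_of v *m E (proj_of v))).
  by apply: poly22_ext (poly22_quartic c) _ => v _; rewrite fid.
have [muD _ _ _ mu1] := hmu.
have p1 : poly22 (fun _ : 'cV[C]_d => 1).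
  by apply: poly22_ext (poly22_quartic _) _; apply: quartic_delta.
rewrite /infid /infid_at.
transitivity (mu (fun v => 1 + -1 * \tr (proj_of v *m E (proj_of v)))).
  symmetry; apply: haar_ext; first exact/poly22D/poly22Z.
  by move=> v _; rewrite mulN1r.
rewrite muD ?haarZ // ?mu1; last exact: poly22Z.
rewrite mulN1r; congr (_ - _).
by rewrite (haar_ext (g := quartic c)) // haar_quarticE.
Qed.

End HaarMoments.

(** * The Schatten 2-norm and the norm of a self-commutator *)

Section Frobenius.
Local Set Implicit Arguments.
Local Unset Strict Implicit.
Local Unset Printing Implicit Defensive.
Variable C : numClosedFieldType.

Lemma adjK m n (A : 'M[C]_(m, n)) : adj (adj A) = A.
Proof. by apply/matrixP => i j; rewrite !adjE conjCK. Qed.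

Lemma adjM m n p (A : 'M[C]_(m, n)) (B : 'M[C]_(n, p)) :
  adj (A *m B) = adj B *m adj A.
Proof. by rewrite /adj map_mxM trmx_mul. Qed.

Lemma adjB m n (A B : 'M[C]_(m, n)) : adj (A - B) = adj A - adj B.
Proof. by rewrite /adj map_mxB linearB. Qed.

Lemma adj_scalar n (a : C) : adj (a%:M : 'M_n) = a^*%:M.
Proof. by rewrite /adj map_scalar_mx tr_scalar_mx. Qed.

Lemma mxtrace_adj n (A : 'M[C]_n) : \tr (adj A) = (\tr A)^*.
Proof. by rewrite rmorph_sum; apply: eq_bigr => i _; rewrite adjE. Qed.

Lemma mxtrace_adjM m n (A : 'M[C]_(m, n)) :
  \tr (adj A *m A) = \sum_i \sum_j `|A i j| ^+ 2.
Proof.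
rewrite exchange_big; apply: eq_bigr => j _; rewrite mxE.
by apply: eq_bigr => i _; rewrite adjE normCK mulrC.
Qed.

Lemma mxtrace_adjM_ge0 m n (A : 'M[C]_(m, n)) : 0 <= \tr (adj A *m A).
Proof.
by rewrite mxtrace_adjM; do 2!apply: sumr_ge0 => ? _; rewrite exprn_ge0.
Qed.

(** Flattening a matrix turns the Frobenius norm into the Euclidean one, which supplies the triangle
    inequality. *)
Lemma dotmx_mxvec m n (A : 'M[C]_(m, n)) :
  dotmx (mxvec A) (mxvec A) = \tr (adj A *m A).
Proof.
rewrite mxtrace_adjM pair_bigA dotmxE mxE /=.
rewrite (reindex _ (curry_mxvec_bij m n)); apply: eq_bigr => -[i j] _ /=.
by rewrite 2!mxE mxvecE normCK.
Qed.

Lemma schatten2D n (A B : 'M[C]_n) :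
  schatten2 (A + B) <= schatten2 A + schatten2 B.
Proof.
by rewrite /schatten2 -!dotmx_mxvec linearD /=;
  apply: (triangle_lerif (@dotmx C _)).
Qed.

Lemma schatten2_sum n (I : finType) (F : I -> 'M[C]_n) :
  schatten2 (\sum_i F i) <= \sum_i schatten2 (F i).
Proof.
elim/big_rec2: _ => [|i y x _ le_xy].
  by rewrite /schatten2 mulmx0 mxtrace0 sqrtC0.
by apply: le_trans (schatten2D _ _) _; rewrite lerD2l.
Qed.

Lemma schatten2Z n (a : C) (A : 'M[C]_n) :
  0 <= a -> schatten2 (a *: A) = a * schatten2 A.
Proof.
move=> a0; rewrite /schatten2.
have -> : adj (a *: A) = a *: adj A.
  by apply/matrixP => i j; rewrite !mxE rmorphM /= (geC0_conj a0).
rewrite -scalemxAl -scalemxAr !mxtraceZ mulrA -expr2.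
by rewrite sqrtCM ?nnegrE ?exprn_ge0 ?mxtrace_adjM_ge0 // sqrCK.
Qed.

(** Entries of a Gram matrix are inner products of columns of A, so Cauchy-Schwarz gives |Q_ij|^2 <=
    Q_ii Q_jj; sum over i and j. *)
Lemma mxtrace_gram_sqr m n (A : 'M[C]_(m, n)) (Q := adj A *m A) :
  \tr (Q *m Q) <= \tr Q ^+ 2.
Proof.
have adjQ : adj Q = Q by rewrite /Q adjM adjK.
rewrite -{1}adjQ mxtrace_adjM expr2 mulr_suml; apply: ler_sum => i _.
rewrite mulr_sumr; apply: ler_sum => j _.
have QE k l : Q k l = dotmx (row l A^T) (row k A^T).
  by rewrite dotmxE !mxE; apply: eq_bigr => h _; rewrite !mxE mulrC.
rewrite !QE [X in _ <= X]mulrC.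
exact: (CauchySchwarz (@dotmx C _)).
Qed.

(* Bottcher-Wenzel inequality in the special case [B = adj A], where
   [tr [A, A^dag]^2 = 2 tr (A^dag A)^2 - 2 |A^dag A^dag|^2]. *)
Lemma schatten2_self_commutator n (A : 'M[C]_n) :
  schatten2 (A *m adj A - adj A *m A) <= sqrtC 2 * \tr (adj A *m A).
Proof.
set t := \tr _; have t0 : 0 <= t by exact: mxtrace_adjM_ge0.
(* The right-hand side becomes the root of 2 t^2, leaving radicands to compare. *)
rewrite /schatten2 -[X in _ * X](sqrCK t0) -sqrtCM ?nnegrE ?exprn_ge0 ?ler0n //.
rewrite ler_sqrtC ?nnegrE ?mulr_ge0 ?exprn_ge0 ?ler0n ?mxtrace_adjM_ge0 //.
rewrite adjB !adjM adjK mulmxBl !mulmxBr !raddfB /=.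
have tPP : \tr (A *m adj A *m (A *m adj A)) = \tr (adj A *m A *m (adj A *m A)).
  by rewrite -mulmxA mxtrace_mulC !mulmxA.
have tPQ : \tr (A *m adj A *m (adj A *m A)) =
    \tr (adj (adj A *m adj A) *m (adj A *m adj A)).
  by rewrite adjM !adjK !mulmxA [LHS]mxtrace_mulC !mulmxA.
have tQP : \tr (adj A *m A *m (A *m adj A)) = \tr (A *m adj A *m (adj A *m A)).
  by rewrite mxtrace_mulC.
rewrite tPP tQP tPQ.
apply: (@le_trans _ _ (2 * \tr (adj A *m A *m (adj A *m A)))); last first.
  by rewrite ler_pM2l ?ltr0n // mxtrace_gram_sqr.
rewrite -subr_ge0; set q := \tr (_ *m _); set r := \tr (_ *m _).
have -> : 2 * q - (q - r + (- r - - q)) = 2 * r by ring.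
by rewrite mulr_ge0 ?ler0n ?mxtrace_adjM_ge0.
Qed.

End Frobenius.

(** * Positive matrices and the Kraus decomposition *)

Section Kraus.
Local Set Implicit Arguments.
Local Unset Strict Implicit.
Local Unset Printing Implicit Defensive.
Variable C : numClosedFieldType.

(** Polarization: the form is real at e_a + z e_b; taking z = 1 and z = ['i] yields the sum and the
    difference of [M a b] and [M b a]. *)
Lemma psd_hermitian n (M : 'M[C]_n) :
  (forall v : 'cV_n, 0 <= (adj v *m M *m v) 0 0) -> adj M = M.
Proof.
move=> Mpos; apply/matrixP => a b; rewrite adjE.
have dE i j : (delta_mx 0 i *m M *m delta_mx j 0 : 'M_1) 0 0 = M i j.
  by rewrite -rowE -colE !mxE.
have adj_delta i : adj (delta_mx i 0 : 'cV[C]_n) = delta_mx 0 i.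
  by apply/matrixP => k l; rewrite !mxE conjC_nat andbC.
pose v z : 'cV[C]_n := delta_mx a 0 + z *: delta_mx b 0.
have qE z : (adj (v z) *m M *m v z) 0 0 =
    M a a + z^* * z * M b b + (z * M a b + z^* * M b a).
  have -> : adj (v z) = delta_mx 0 a + z^* *: delta_mx 0 b.
    by apply/matrixP => i j; rewrite !mxE rmorphD rmorphM /= !conjC_nat
      !(andbC (j == _)).
  rewrite mulmxDr !mulmxDl -!scalemxAl -!scalemxAr.
  have eD (X Y : 'M[C]_1) : (X + Y) 0 0 = X 0 0 + Y 0 0 by rewrite mxE.
  have eZ x (X : 'M[C]_1) : (x *: X) 0 0 = x * X 0 0 by rewrite mxE.
  by rewrite !(eD, eZ) !dE; ring.
have real z : (M a a + z^* * z * M b b + (z * M a b + z^* * M b a))^* =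
              M a a + z^* * z * M b b + (z * M a b + z^* * M b a).
  by rewrite -qE; apply: geC0_conj.
have diag c : (M c c)^* = M c c.
  by rewrite geC0_conj //; have := Mpos (delta_mx c 0); rewrite adj_delta dE.
have conjz z : z * M a b + z^* * M b a = z^* * (M a b)^* + z * (M b a)^*.
  have := real z; rewrite !rmorphD !rmorphM /= !conjCK !diag (mulrC z).
  by move=> /addrI <-.
have h1 := conjz 1; have hi := conjz 'i.
have ii : ('i : C) * 'i = -1 by rewrite -expr2 sqrCi.
have two : (2 : C) != 0 by rewrite pnatr_eq0.
move: h1 hi; rewrite conjC1 conjCi !mul1r !mulNr => h1 hi.
have h2 : M a b - M b a = (M b a)^* - (M a b)^*.
  have -> : M a b - M b a = - 'i * ('i * M a b - 'i * M b a) :> C.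
    by rewrite mulrBr !mulrA !mulNr ii !mulN1r !opprK.
  by rewrite hi mulrDr mulrN !mulrA !mulNr ii !mulN1r !opprK addrC.
apply: (mulfI two).
have -> : 2 * M a b = (M a b + M b a) + (M a b - M b a) by ring.
by rewrite h1 h2; ring.
Qed.

(** Diagonalize M as P^dag D P with P unitary; D is nonnegative, and W = P^dag D^(1/2). *)
Lemma psd_factor n (M : 'M[C]_n) :
  (forall v : 'cV_n, 0 <= (adj v *m M *m v) 0 0) ->
  exists W : 'M[C]_n, M = W *m adj W.
Proof.
move=> Mpos; have Mh := psd_hermitian Mpos.
have Mherm : M \is hermsymmx.
  by apply/is_hermitianmxP; rewrite expr0 scale1r -{1}Mh /adj map_trmx.
have /orthomx_spectralP := hermitian_normalmx Mherm.
set P := spectralmx M; set D := spectral_diag M.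
have Pu : P \is unitarymx := spectral_unitarymx M.
rewrite invmx_unitary //.
have -> : map_mx Num.conj P^T = adj P by rewrite /adj map_trmx.
move=> ME.
have PP : P *m adj P = 1%:M by have /unitarymxP := Pu; rewrite /adj map_trmx.
have DE : diag_mx D = P *m M *m adj P.
  by rewrite ME !mulmxA PP mul1mx -mulmxA PP mulmx1.
(* Each eigenvalue is the value of the form at the corresponding eigenvector. *)
have D0 s : 0 <= D 0 s.
  have := Mpos (adj (row s P)); rewrite adjK -row_mul => h.
  suff -> : D 0 s = (row s (P *m M) *m adj (row s P)) 0 0 by [].
  have /matrixP/(_ s s) := DE; rewrite mxE eqxx mulr1n => ->.
  by rewrite !mxE; apply: eq_bigr => j _; rewrite !mxE.
exists (adj P *m diag_mx (map_mx sqrtC D)).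
rewrite adjM adjK mulmxA -(mulmxA (adj P)) [LHS]ME; congr (_ *m _ *m _).
apply/matrixP => i j; rewrite [RHS]mxE (bigD1 i) //= big1 => [|k ki].
  rewrite adjE !mxE eqxx mulr1n addr0 eq_sym.
  have [->|ij] := eqVneq; last first.
    by rewrite !mulr0n conjC0 mulr0.
  by rewrite !mulr1n (geC0_conj _) ?sqrtC_ge0 // -expr2 sqrtCK.
by rewrite !mxE eq_sym (negPf ki) mulr0n mul0r.
Qed.

Lemma form_sum n (x y : 'cV[C]_n) (A : 'M[C]_n) :
  (adj x *m A *m y) 0 0 = \sum_a \sum_b (x a 0)^* * A a b * y b 0.
Proof.
rewrite mxE exchange_big; apply: eq_bigr => b _ /=.
by rewrite mxE mulr_suml; apply: eq_bigr => a _; rewrite adjE.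
Qed.

(** Choi's argument: the Choi matrix [J], with rows and columns indexed by enumerated pairs, is
    positive, and the columns of a factor [W] reshape into Kraus operators. *)
Lemma kraus d (E : {linear 'M[C]_d -> 'M[C]_d}) :
  completely_positive E ->
  exists n (K : 'I_n -> 'M[C]_d), forall X, E X = \sum_s K s *m X *m adj (K s).
Proof.
move=> cpE; pose n := #|{: 'I_d * 'I_d}|.
pose ev (a : 'I_n) : 'I_d * 'I_d := enum_val a.
pose J : 'M[C]_n := \matrix_(a, b)
  E (delta_mx (ev a).1 (ev b).1) (ev a).2 (ev b).2.
have sumE (F : 'I_d -> 'I_d -> C) :
    \sum_(a : 'I_n) F (ev a).1 (ev a).2 = \sum_i \sum_p F i p.
  rewrite pair_bigA /= [RHS](reindex ev) //=.
  exact/onW_bij/enum_val_bij.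
(* The blocks form the unnormalized maximally entangled projector, whose form at w is |S|^2. *)
have psd : psd_block (fun i j => delta_mx i j : 'M[C]_d).
  move=> w; pose S := \sum_i w i i 0.
  suff -> : \sum_i \sum_j (adj (w i) *m delta_mx i j *m w j) 0 0 = S * S^*.
    exact: mul_conjC_ge0.
  rewrite mulrC rmorph_sum mulr_suml; apply: eq_bigr => i _ /=.
  rewrite mulr_sumr; apply: eq_bigr => j _.
  rewrite -(mul_delta_mx (0 : 'I_1)) mulmxA -colE -mulmxA -rowE mxE big_ord1.
  by rewrite !mxE.
have [v|W JE] := @psd_factor _ J.
  have := cpE _ _ psd (fun i => \col_p v (enum_rank (i, p)) 0).
  congr (0 <= _); rewrite form_sum.
  pose F i p j q :=
    (v (enum_rank (i, p)) 0)^* * E (delta_mx i j) p q * v (enum_rank (j, q)) 0.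
  transitivity (\sum_(a : 'I_n) \sum_(b : 'I_n)
    F (ev a).1 (ev a).2 (ev b).1 (ev b).2); last first.
    apply: eq_bigr => a _; apply: eq_bigr => b _.
    by rewrite /F mxE -!surjective_pairing /ev !enum_valK.
  rewrite (sumE (fun i p => \sum_(b : 'I_n) F i p (ev b).1 (ev b).2)).
  apply: eq_bigr => i _; under [RHS]eq_bigr => p _ do rewrite sumE.
  rewrite [RHS]exchange_big; apply: eq_bigr => j _ /=; rewrite form_sum.
  by do 2!apply: eq_bigr => ? _; rewrite !mxE.
exists n, (fun s => \matrix_(p, i) W (enum_rank (i, p)) s) => X.
have dE i j p q : E (delta_mx i j) p q =
   \sum_s W (enum_rank (i, p)) s * (W (enum_rank (j, q)) s)^*.
  have /matrixP/(_ (enum_rank (i, p)) (enum_rank (j, q))) := JE.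
  rewrite [LHS]mxE /ev !enum_rankK /= => ->.
  by rewrite mxE; apply: eq_bigr => s _; rewrite adjE.
apply/matrixP => p q.
rewrite {1}[X]matrix_sum_delta linear_sum !summxE.
transitivity (\sum_i \sum_j \sum_s
  X i j * (W (enum_rank (i, p)) s * (W (enum_rank (j, q)) s)^*)).
  apply: eq_bigr => i _; rewrite linear_sum summxE; apply: eq_bigr => j _.
  by rewrite linearZ mxE dE mulr_sumr.
under eq_bigr => i _ do rewrite exchange_big.
rewrite exchange_big; apply: eq_bigr => s _ /=.
rewrite mxE exchange_big; apply: eq_bigr => j _ /=.
rewrite mxE mulr_suml; apply: eq_bigr => i _ /=.
by rewrite adjE !mxE; ring.
Qed.

End Kraus.

(** * Trace preservation and the unital defect in Kraus form *)

Lemma kraus_isometry (C : numClosedFieldType) d n (E : 'M[C]_d -> 'M[C]_d)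
    (K : 'I_n -> 'M[C]_d) :
  trace_preserving E -> (forall X, E X = \sum_s K s *m X *m adj (K s)) ->
  \sum_s adj (K s) *m K s = 1%:M.
Proof.
move=> tpE KE; apply/matrixP => i j.
(* The trace of K e_j e_i^T K^dag is the (i,j) entry of K^dag K. *)
have := tpE (delta_mx j i); rewrite KE raddf_sum summxE /=.
have -> : \tr (delta_mx j i : 'M[C]_d) = (1%:M : 'M_d) i j.
  rewrite /mxtrace; under eq_bigr => k _ do rewrite mxE -mulnb natrM.
  by rewrite sum_delta mxE eq_sym.
move=> <-; apply: eq_bigr => s _.
rewrite -mulmxA mxtrace_mulC -mulmxA -(mul_delta_mx (0 : 'I_1)).
rewrite -mulmxA mxtrace_mulC.
by rewrite trace_mx11 -rowE -colE !mxE.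
Qed.

(* The unital defect only sees the traceless parts of the Kraus operators. *)
Lemma schatten2_kraus_commutator (C : numClosedFieldType) d (K : 'M[C]_d) :
  (0 < d)%N ->
  schatten2 (K *m adj K - adj K *m K)
    <= sqrtC 2 * (\tr (adj K *m K) - `|\tr K| ^+ 2 / d%:R).
Proof.
move=> d0; have dn0 : (d%:R : C) != 0 by rewrite pnatr_eq0 -lt0n.
pose a := \tr K / d%:R; pose A := K - a%:M.
have aE : a^* = (\tr K)^* / d%:R by rewrite /a rmorphM fmorphV /= conjC_nat.
have -> : K *m adj K - adj K *m K = A *m adj A - adj A *m A.
  rewrite /A adjB adj_scalar !mulmxBl !mulmxBr !mul_scalar_mx !mul_mx_scalar.
  by apply/matrixP => i j; rewrite !mxE; ring.
(* A is the orthogonal projection of K onto the traceless matrices; this is Pythagoras. *)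
have -> : \tr (adj K *m K) - `|\tr K| ^+ 2 / d%:R = \tr (adj A *m A).
  rewrite /A adjB adj_scalar mulmxBl !mulmxBr !mul_scalar_mx !mul_mx_scalar.
  rewrite -scalemx1 !raddfB /= !mxtraceZ mxtrace1 mxtrace_adj aE /a normCK.
  by field.
exact: schatten2_self_commutator.
Qed.

Theorem theorem3 (C : numClosedFieldType) (d : nat) (hd : (0 < d)%N)
    (mu : ('cV[C]_d -> C) -> C) (hmu : haar_avg22 mu)
    (E : {linear 'M[C]_d -> 'M[C]_d}) (hE : CPTP E) :
  schatten2 (E (d%:R^-1 *: 1%:M) - d%:R^-1 *: 1%:M)
    <= sqrtC 2 * (d.+1)%:R * infid mu E / d%:R.
Proof.
have [/kraus[n [K KE]] tpE] := hE.
have KK := kraus_isometry _ _ _ _ _ tpE KE.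
have dn0 : (d%:R : C) != 0 by rewrite pnatr_eq0 -lt0n.
have d1n0 : (d.+1%:R : C) != 0 by rewrite pnatr_eq0.
pose T := \sum_s `|\tr (K s)| ^+ 2.
have rE : infid mu E = 1 - (d%:R + T) / (d%:R * d.+1%:R).
  rewrite infidE //; congr (_ - _ / _).
  under eq_bigr => i _ do rewrite big_split.
  rewrite big_split /=; congr (_ + _).
    (* The first pairing is tr E(1) = d, by trace preservation. *)
    rewrite exchange_big /= -[RHS]mxtrace1; apply: eq_bigr => j _.
    have := tpE (delta_mx j j); rewrite /mxtrace => ->.
    rewrite (bigD1 j) //= big1 ?addr0 ?mxE ?eqxx // => k /negPf kj.
    by rewrite mxE kj.
  (* In the second, each K contributes the sum of K_ii times the conjugate of K_jj, that is |tr
     K|^2. *)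
  rewrite /T; under eq_bigr => i _ do under eq_bigr => j _ do rewrite KE summxE.
  under eq_bigr => i _ do rewrite exchange_big.
  rewrite exchange_big; apply: eq_bigr => s _ /=.
  rewrite normCK rmorph_sum mulr_suml; apply: eq_bigr => i _ /=.
  rewrite mulr_sumr; apply: eq_bigr => j _.
  rewrite -(mul_delta_mx (0 : 'I_1)) mulmxA -colE -mulmxA -rowE mxE big_ord1.
  by rewrite !mxE.
(* The identity being subtracted is replaced by the sum of K^dag K, which leaves commutators. *)
have -> : E (d%:R^-1 *: 1%:M) - d%:R^-1 *: 1%:M =
    d%:R^-1 *: \sum_s (K s *m adj (K s) - adj (K s) *m K s).
  rewrite linearZ /= -scalerBr sumrB KK KE; congr (_ *: (_ - _)).
  by apply: eq_bigr => s _; rewrite mulmx1.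
rewrite schatten2Z ?invr_ge0 ?ler0n // mulrC ler_pM2r ?invr_gt0 ?ltr0n //.
apply: le_trans (schatten2_sum _) _.
apply: (@le_trans _ _ (\sum_s sqrtC 2 *
  (\tr (adj (K s) *m K s) - `|\tr (K s)| ^+ 2 / d%:R))).
  by apply: ler_sum => s _; apply: schatten2_kraus_commutator.
rewrite -mulr_sumr sumrB -raddf_sum KK /= mxtrace1 -mulr_suml -/T rE.
(* Equality holds here: (d + 1) r = d + 1 - (d + T) / d = d - T / d. *)
rewrite le_eqVlt; apply/orP; left; rewrite -mulrA; apply/eqP; congr (_ * _).
by field; rewrite nat1r d1n0.
Qed.
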